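(* Let $X$ be a Polish space with topology $\tau_X$ and let $T:X\to X$ be $\tau_X$-continuous. Assume that $X$ is also endowed with a Hausdorff topology $\tau$ coarser than $\tau_X$ such that every point of $X$ has a $\tau_X$-neighbourhood basis consisting of $\tau$-compact sets. Assume moreover that (i) $T$ is frequently hypercyclic with respect to $\tau_X$, and (ii) $T$ is a continuous self-map of $(X,\tau)$. Then $T$ admits a $T$-invariant Borel probability measure with full support (with respect to $\tau_X$).
   Context: For $x\in X$ and $B\subset X$, $\mathcal N_T(x,B)=\{n\in\mathbb N: T^nx\in B\}$. $T$ is frequently hypercyclic (w.r.t. $\tau_X$) if there is $x\in X$ such that for every nonempty $\tau_X$-open $V$, the set $\mathcal N_T(x,V)$ has positive lower density, i.e. $\liminf_{N\to\infty}\frac1N\#(\mathcal N_T(x,V)\cap[1,N])>0$. A measure $m$ is $T$-invariant if $m(T^{-1}(A))=m(A)$ for all Borel $A$, and has full support if $m(U)>0$ for each nonempty $\tau_X$-open $U$. *)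

(* Defs.v *)
From HB Require Import structures.
From mathcomp Require Import all_boot all_order all_algebra.
From mathcomp Require Import all_classical all_reals all_analysis.
Set Implicit Arguments. Unset Strict Implicit. Unset Printing Implicit Defensive.
Import Order.TTheory GRing.Theory Num.Theory.
Import numFieldNormedType.Exports.
Local Open Scope classical_set_scope.
Local Open Scope ring_scope.

Definition polish (R : realType) (X : ptopologicalType) : Prop :=
  (exists D : set X, countable D /\ dense D) /\
  exists d : X -> X -> R,
    [/\ (forall x y, 0 <= d x y),
        (forall x y, d x y = 0 <-> x = y),
        (forall x y, d x y = d y x),
        (forall x y z, d x z <= d x y + d y z) &
      (forall A : set X, open A <->
            (forall x, A x -> exists2 e : R, 0 < e & [set y | d x y < e] `<=` A)) /\
        (forall u : nat -> X,
            (forall e : R, 0 < e -> exists N, forall m n, (N <= m)%N -> (N <= n)%N ->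
                d (u m) (u n) < e) ->
            exists l : X, u @ \oo --> l)].

(* A second topology on the carrier X, given by its family of open sets. *)
Definition is_topology (X : Type) (tau : set (set X)) : Prop :=
  [/\ tau set0, tau setT,
      (forall A B, tau A -> tau B -> tau (A `&` B)) &
      (forall S : set (set X), S `<=` tau -> tau (\bigcup_(A in S) A))].

Definition tau_hausdorff (X : Type) (tau : set (set X)) : Prop :=
  forall x y : X, x <> y ->
    exists U V, [/\ tau U, tau V, U x, V y & U `&` V = set0].

Definition tau_compact (X : Type) (tau : set (set X)) (K : set X) : Prop :=
  forall S : set (set X), S `<=` tau -> K `<=` \bigcup_(A in S) A ->
    exists F : set (set X), [/\ finite_set F, F `<=` S & K `<=` \bigcup_(A in F) A].

Definition tau_continuous (X : Type) (tau : set (set X)) (f : X -> X) : Prop :=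
  forall V, tau V -> tau (f @^-1` V).

Definition lower_density (R : realType) (X : Type) (T : X -> X) (x : X) (B : set X)
  : \bar R :=
  limn_einf (fun N : nat =>
    ((\sum_(1 <= n < N.+1) (\1_B (iter n T x) : R)) / N%:R)%:E).

Definition freq_hypercyclic (R : realType) (X : ptopologicalType) (T : X -> X) : Prop :=
  exists x : X, forall V : set X, open V -> V !=set0 ->
    (0 < lower_density R T x V)%E.

Notation borel X := (g_sigma_algebraType (@open X)).

(* Main.v *)
(** Let [x] be a frequently hypercyclic point.  The limit [nu A], along a free
    ultrafilter, of the visit frequencies of the orbit of [x] to [A] is a
    [T]-invariant finitely additive probability defined on all subsets of [X],
    and it charges every nonempty open set.  It is made countably additive by
      [mu E := inf (sup (nu K))],
    the supremum being over the [tau]-compact [K] contained in [U] and the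
    infimum over the [tau]-open [U] containing [E].  In a Hausdorff space this
    is an outer measure for which [tau]-open sets are Caratheodory measurable,
    and the Borel sets are too because every open set is a countable union of
    [tau]-compact sets.  Full support survives since [nu K <= mu K] for
    [tau]-compact [K].  As [T] maps [tau]-compact sets to [tau]-compact sets
    and pulls [tau]-open sets back to [tau]-open sets, [mu (T^-1 E) <= mu E];
    applying this to [E] and to its complement gives equality.  It remains to
    normalize [mu]. *)
Require Import Defs.
From HB Require Import structures.
From mathcomp Require Import all_boot all_order all_algebra.
From mathcomp Require Import lra.
From mathcomp Require Import all_classical all_reals all_analysis.
Set Implicit Arguments.
Unset Strict Implicit.
Unset Printing Implicit Defensive.
Import Order.TTheory GRing.Theory Num.Theory.
Import numFieldNormedType.Exports.
Local Open Scope classical_set_scope.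
Local Open Scope ring_scope.

(** * Compact sets in a Hausdorff topology given by its family of open sets *)

Section tau_topology.
Context {X : Type} {tau : set (set X)}.
Hypotheses (tauT : is_topology tau) (tauH : tau_hausdorff tau).
Implicit Types (A B K U V : set X).

Lemma tau_open_setU U V : tau U -> tau V -> tau (U `|` V).
Proof.
case: tauT => _ _ _ tauU tU tV; rewrite -bigcup2E.
have -> : \bigcup_i bigcup2 U V i = \bigcup_(A in [set U; V]) A.
  rewrite bigcup2E; apply/seteqP; split => x.
    by case=> ?; [exists U; [left|]|exists V; [right|]].
  by case=> A [->|->] ?; [left|right].
by apply: tauU => A [->|->].
Qed.

Lemma tau_open_local U :
  (forall x, U x -> exists V, [/\ tau V, V x & V `<=` U]) -> tau U.
Proof.
case: tauT => _ _ _ tauU hU.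
have -> : U = \bigcup_(V in [set V | tau V /\ V `<=` U]) V.
  apply/seteqP; split => [x /hU[V [tV Vx VU]]|x [V [_ VU] Vx]]; last exact: VU.
  by exists V.
by apply: tauU => V [].
Qed.

(** Compactness as an induction principle: if the sets satisfying [P] form an ideal and every point
    of [K] has a [tau]-open neighbourhood in it, a finite subcover of [K] by such neighbourhoods is
    added up one member at a time. *)
Lemma tau_compact_ind (P : set X -> Prop) K :
  P set0 -> (forall A B, P A -> P B -> P (A `|` B)) ->
  (forall A B, A `<=` B -> P B -> P A) ->
  (forall x, K x -> exists U, [/\ tau U, U x & P U]) ->
  tau_compact tau K -> P K.
Proof.
move=> P0 PU PS PK cK.
have [|x Kx|F [/finite_seqP[s ->] FS KF]] := cK [set U | tau U /\ P U].
- by move=> U [].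
- by have [U [tU Ux PUx]] := PK x Kx; exists U.
apply: PS KF _; elim: s FS => [|U s IHs] FS.
  by rewrite bigcup_seq big_nil.
rewrite bigcup_seq big_cons -bigcup_seq; apply: PU.
  by have /FS[] : [set` U :: s] U by rewrite /= mem_head.
by apply: IHs => V /= Vs; apply: FS; rewrite /= in_cons Vs orbT.
Qed.

(** The sets that can be separated from [B] form an ideal: for a union, take the union of the
    neighbourhoods on one side and the intersection on the other. *)
Lemma tau_compact_separation K B : tau_compact tau K ->
  (forall x, K x ->
    exists U V, [/\ tau U, tau V, U x, B `<=` V & U `&` V = set0]) ->
  exists U V, [/\ tau U, tau V, K `<=` U, B `<=` V & U `&` V = set0].
Proof.
case: (tauT) => tau0 tau1 tauI _ cK hK; move: cK.
apply: (@tau_compact_ind (fun K => exists U V,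
  [/\ tau U, tau V, K `<=` U, B `<=` V & U `&` V = set0])).
- by exists set0, setT; split => //; rewrite set0I.
- move=> A1 A2 [U1 [V1 [tU1 tV1 AU1 BV1 UV1]]] [U2 [V2 [tU2 tV2 AU2 BV2 UV2]]].
  exists (U1 `|` U2), (V1 `&` V2); split.
  + exact: tau_open_setU.
  + exact: tauI.
  + exact: setUSS.
  + by rewrite subsetI.
  + apply/seteqP; split => // x [[U1x|U2x] [V1x V2x]].
      by rewrite -UV1.
    by rewrite -UV2.
- by move=> A1 A2 A12 [U [V [tU tV /(subset_trans A12) ? ? ?]]]; exists U, V.
- move=> x /hK[U [V [tU tV Ux BV UV]]]; exists U; split => //.
  by exists U, V; split.
Qed.

Lemma tau_compact_disjoint_separation K B :
  tau_compact tau K -> tau_compact tau B -> K `&` B = set0 ->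
  exists U V, [/\ tau U, tau V, K `<=` U, B `<=` V & U `&` V = set0].
Proof.
move=> cK cB KB; apply: tau_compact_separation cK _ => x Kx.
(* The separation lemma is used a second time, with [B] as the compact set and the point [x] as the
   other one; only here does the Hausdorff property enter. *)
have [|U [V [tU tV BU xV UV]]] := tau_compact_separation (B := [set x]) cB.
  move=> y By; have [|U [V [tU tV Uy Vx UV]]] := @tauH y x.
    by move=> yx; have : (K `&` B) x; [split => //; rewrite -yx|rewrite KB].
  by exists U, V; split => // _ ->.
by exists V, U; split; rewrite ?[V `&` U]setIC//; exact: xV.
Qed.

Lemma tau_compact_set1 (x : X) : tau_compact tau [set x].
Proof.
move=> S _ /(_ x erefl)[U SU Ux]; exists [set U]; split => //.
- by move=> _ ->.
- by move=> _ ->; exists U.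
Qed.

Lemma tau_compact_closed K : tau_compact tau K -> tau (~` K).
Proof.
move=> cK; apply: tau_open_local => x Kx.
have [||U [V [tU tV KU xV UV]]] :=
  tau_compact_disjoint_separation (B := [set x]) cK.
- exact: tau_compact_set1.
- by apply/seteqP; split => // y [Ky yx]; apply: Kx; rewrite -yx.
exists V; split => //; first exact: xV.
by move=> y Vy /KU Uy; have : (U `&` V) y by []; rewrite UV.
Qed.

Lemma tau_compact_setU A B :
  tau_compact tau A -> tau_compact tau B -> tau_compact tau (A `|` B).
Proof.
move=> cA cB S St; rewrite subUset => -[AS BS].
have [F [fF FS AF]] := cA S St AS; have [G [fG GS BG]] := cB S St BS.
exists (F `|` G); split; [by rewrite finite_setU|by rewrite subUset|].
by rewrite bigcup_setU; exact: setUSS.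
Qed.

Lemma tau_compact0 : tau_compact tau set0.
Proof.
by move=> S St _; exists set0; split => //; exact: finite_set0.
Qed.

(** Adding [U] to a cover of the difference covers [K]; [U] is then discarded from the finite
    subcover. *)
Lemma tau_compact_setD K U :
  tau_compact tau K -> tau U -> tau_compact tau (K `\` U).
Proof.
move=> cK tU S St KUS; have [||F [fF FS KF]] := cK (S `|` [set U]).
- by rewrite subUset; split => // _ ->.
- move=> x Kx; have [Ux|nUx] := pselect (U x); first by exists U => //; right.
  by have [V SV Vx] := KUS x (conj Kx nUx); exists V => //; left.
exists (F `&` S); split; [exact: finite_setIl|by move=> ? []|].
move=> x [/KF[V FV Vx] nUx]; exists V => //; split => //.
by have [//|VU] := FS V FV; rewrite VU in Vx.
Qed.

Lemma tau_compact_image (f : X -> X) K :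
  tau_continuous tau f -> tau_compact tau K -> tau_compact tau (f @` K).
Proof.
move=> cf cK S St fKS; move: cK.
apply: (@tau_compact_ind (fun A => exists F,
  [/\ finite_set F, F `<=` S & f @` A `<=` \bigcup_(V in F) V])).
- by exists set0; split; [exact: finite_set0|by []|rewrite image_set0].
- move=> A B [F [fF FS AF]] [G [fG GS BG]]; exists (F `|` G).
  split; [by rewrite finite_setU|by rewrite subUset|].
  by rewrite image_setU bigcup_setU; exact: setUSS.
- move=> A B AB [F [fF FS BF]]; exists F; split => //.
  exact: subset_trans (image_subset f AB) BF.
- move=> x Kx; have [|V SV Vfx] := fKS (f x); first by exists x.
  exists (f @^-1` V); split => //; first exact/cf/St.
  exists [set V]; split; [exact: finite_set1|by move=> _ ->|].
  by move=> _ [y Vy <-]; exists V.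
Qed.

(** The compact sets [K \ U] and [K \ V] are disjoint, hence have disjoint open neighbourhoods.
    Removing each neighbourhood from [K] gives the two pieces, and no point of [K] is removed from
    both. *)
Lemma tau_compact_split K U V : tau_compact tau K -> tau U -> tau V ->
  K `<=` U `|` V -> exists A B, [/\ tau_compact tau A, tau_compact tau B,
    A `<=` U, B `<=` V & K = A `|` B].
Proof.
move=> cK tU tV KUV.
have [|||U' [V' [tU' tV' KU' KV' UV']]] :=
  @tau_compact_disjoint_separation (K `\` U) (K `\` V).
- exact: tau_compact_setD.
- exact: tau_compact_setD.
- by apply/seteqP; split => // x [[/KUV[//|Vx] _] []].
exists (K `\` U'), (K `\` V'); split.
- exact: tau_compact_setD.
- exact: tau_compact_setD.
- by move=> x [Kx U'x]; apply: contrapT => Ux; apply: U'x; exact: KU'.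
- by move=> x [Kx V'x]; apply: contrapT => Vx; apply: V'x; exact: KV'.
- by rewrite -setDIr UV' setD0.
Qed.

End tau_topology.

(** * From a finitely additive set function to an outer measure *)

Section compact_regularization.
Context {R : realType} {X : Type} (tau : set (set X)) (nu : set X -> R).
Implicit Types (A B E K U V : set X).

Definition inner_content U : \bar R :=
  ereal_sup [set (nu K)%:E | K in [set K | tau_compact tau K /\ K `<=` U]].

Definition outer_content E : \bar R :=
  ereal_inf [set inner_content U | U in [set U | tau U /\ E `<=` U]].

Hypotheses (tauT : is_topology tau) (tauH : tau_hausdorff tau).
Hypotheses (nu_ge0 : forall A, 0 <= nu A)
  (nuU : forall A B, A `&` B = set0 -> nu (A `|` B) = nu A + nu B).

Lemma additive_set0 : nu set0 = 0.
Proof. by apply: (addrI (nu set0)); rewrite -nuU ?setI0// setU0 addr0. Qed.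

Lemma additive_le A B : A `<=` B -> nu A <= nu B.
Proof.
by move=> AB; rewrite -(setDUK AB) nuU ?setDIK// lerDl.
Qed.

Lemma additive_subadditive A B : nu (A `|` B) <= nu A + nu B.
Proof.
have -> : A `|` B = A `|` (B `\` A).
  apply/seteqP; split => x; last by case=> [|[]]; [left|right].
  by case=> [|Bx]; [left|have [|] := pselect (A x); [left|right]].
by rewrite nuU ?setDIK// lerD2l; apply: additive_le => x [].
Qed.

Local Open Scope ereal_scope.

Lemma inner_content_ub U K :
  tau_compact tau K -> K `<=` U -> (nu K)%:E <= inner_content U.
Proof. by move=> cK KU; apply: ereal_sup_ubound; exists K. Qed.

Lemma inner_content_ge0 U : 0 <= inner_content U.
Proof.
by have := inner_content_ub tau_compact0 (@sub0set _ U); rewrite additive_set0.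
Qed.

Lemma inner_content_fin_num U : inner_content U \is a fin_num.
Proof.
rewrite ge0_fin_numE ?inner_content_ge0//.
apply: (@le_lt_trans _ _ (nu setT)%:E); last exact: ltry.
by apply: ge_ereal_sup => _ [K _ <-]; rewrite lee_fin additive_le.
Qed.

(** Countable subadditivity comes from compactness: a compact subset of the union meets the problem
    at a finite stage, where it splits into compact pieces, one inside each [U i], and finite
    subadditivity of [nu] applies. *)
Lemma inner_content_sigma_subadditive (U : nat -> set X) :
  (forall i, tau (U i)) ->
  inner_content (\bigcup_i U i) <= \sum_(i <oo) inner_content (U i).
Proof.
move=> tU; apply: ge_ereal_sup => _ [K [cK KU] <-].
have tU_n n : tau (\big[setU/set0]_(i < n) U i).
  case: tauT => tau0 _ _ _.
  by elim/big_ind : _ => // A B; exact: tau_open_setU.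
have [n KUn] : exists n, K `<=` \big[setU/set0]_(i < n) U i.
  move: cK.
  apply: (@tau_compact_ind _ tau
    (fun A => exists n, A `<=` \big[setU/set0]_(i < n) U i)).
  - by exists 0%N.
  - move=> A B [n An] [m Bm]; exists (maxn n m); rewrite subUset; split.
      by apply: (subset_trans An); apply: subset_bigsetU; exact: leq_maxl.
    by apply: (subset_trans Bm); apply: subset_bigsetU; exact: leq_maxr.
  - by move=> A B AB [n Bn]; exists n; exact: subset_trans Bn.
  - move=> x /KU[i _ Ux]; exists (U i); split => //; exists i.+1.
    by rewrite big_ord_recr/=; exact: subsetUr.
have : (nu K)%:E <= \sum_(0 <= i < n) inner_content (U i).
  (* [K] is generalized, since the induction hypothesis is applied to the piece lying in the first
     [n] sets. *)
  elim: n K cK KUn {KU} => [|n IHn] K cK.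
    by rewrite big_ord0 subset0 => ->; rewrite big_geq// additive_set0.
  rewrite big_ord_recr/= => KUn.
  have [A [B [cA cB AU BU ->]]] := tau_compact_split tauT tauH cK (tU_n n)
    (tU n) KUn.
  rewrite big_nat_recr//= (@le_trans _ _ ((nu A)%:E + (nu B)%:E))//.
    by rewrite -EFinD lee_fin additive_subadditive.
  by rewrite leeD//; [exact: IHn|exact: inner_content_ub].
move=> /le_trans; apply; apply: nneseries_lim_ge => i _ _.
exact: inner_content_ge0.
Qed.

Lemma outer_content_le_inner E U :
  tau U -> E `<=` U -> outer_content E <= inner_content U.
Proof. by move=> tU EU; apply: ereal_inf_lbound; exists U. Qed.

Lemma compact_le_outer_content K E : tau_compact tau K -> K `<=` E ->
  (nu K)%:E <= outer_content E.
Proof.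
move=> cK KE; apply: le_ereal_inf_tmp => _ [U [tU EU] <-].
by apply: inner_content_ub => //; exact: subset_trans EU.
Qed.

Lemma outer_content_ge0 E : 0 <= outer_content E.
Proof.
by apply: le_ereal_inf_tmp => _ [U _ <-]; exact: inner_content_ge0.
Qed.

Lemma outer_content_fin_num E : outer_content E \is a fin_num.
Proof.
rewrite ge0_fin_numE ?outer_content_ge0//.
apply: (@le_lt_trans _ _ (inner_content setT)).
  by apply: outer_content_le_inner => //; case: tauT.
by rewrite -ge0_fin_numE ?inner_content_fin_num// inner_content_ge0.
Qed.

Lemma outer_content0 : outer_content set0 = 0.
Proof.
apply/eqP; rewrite eq_le outer_content_ge0 andbT.
have tau0 : tau set0 by case: tauT.
apply: le_trans (outer_content_le_inner tau0 _) _ => //.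
by apply: ge_ereal_sup => _ [K [_ K0] <-]; move: K0; rewrite subset0 => ->;
  rewrite additive_set0.
Qed.

Lemma le_outer_content : {homo outer_content : A B / A `<=` B >-> A <= B}.
Proof.
move=> A B AB; apply: ereal_inf_le_tmp => _ [U [tU BU] <-].
by exists U => //; split => //; exact: subset_trans BU.
Qed.

Lemma outer_content_adherent E (e : R) : (0 < e)%R ->
  exists U, [/\ tau U, E `<=` U & inner_content U <= outer_content E + e%:E].
Proof.
move=> e0.
have [_ [U [tU EU] <-] /ltW] :=
  lb_ereal_inf_adherent e0 (outer_content_fin_num E).
by exists U.
Qed.

Lemma outer_content_sigma_subadditive : sigma_subadditive outer_content.
Proof.
move=> A; apply/lee_addgt0Pr => e e0.
have /choice[U PU] : forall n, exists U, [/\ tau U, A n `<=` U &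
    inner_content U <= outer_content (A n) + (e / (2 ^ n.+1)%:R)%:E].
  by move=> n; apply: outer_content_adherent; rewrite divr_gt0.
(* The errors [e / 2 ^ n.+1] of the open approximations sum to [e]. *)
rewrite (le_trans _ (epsilon_trick _ _ (ltW e0)))//; last first.
  by move=> n; exact: outer_content_ge0.
apply: (@le_trans _ _ (inner_content (\bigcup_n U n))).
  apply: outer_content_le_inner.
    case: tauT => _ _ _; rewrite -(bigcup_image setT U id); apply.
    by move=> _ [n _ <-]; have [] := PU n.
  by apply: subset_bigcup => n _; have [] := PU n.
apply: le_trans (inner_content_sigma_subadditive _) _.
  by move=> n; have [] := PU n.
apply: lee_nneseries => [n _ _|n _]; first exact: inner_content_ge0.
by have [] := PU n.
Qed.

Definition outer_content_measure : {outer_measure set X -> \bar R} :=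
  HB.pack outer_content (isOuterMeasure.Build R X outer_content outer_content0
    outer_content_ge0 le_outer_content outer_content_sigma_subadditive).

(** A compact subset of [V \ K] is disjoint from [K], so its union with [K] competes in the supremum
    for [V]. *)
Lemma inner_content_setD V K : tau V -> tau_compact tau K -> K `<=` V ->
  (nu K)%:E + inner_content (V `\` K) <= inner_content V.
Proof.
move=> tV cK KV; rewrite -leeBrDl//; apply: ge_ereal_sup => _ [B [cB BVK] <-].
rewrite leeBrDl// -EFinD -nuU; last first.
  by apply/seteqP; split => // x [Kx /BVK[]].
apply: inner_content_ub; first exact: tau_compact_setU.
by rewrite subUset; split => // x /BVK[].
Qed.

(** It suffices to test an open [V] containing [E]. There [V & U] is approximated from inside by a
    compact [K], and [V \ K] is an open set containing [V \ U], so the previous inequality for [K]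
    and [V] concludes. *)
Lemma tau_open_caratheodory U :
  tau U -> outer_content_measure.-caratheodory U.
Proof.
move=> tU; apply: le_caratheodory_measurable => E /=.
apply: le_ereal_inf_tmp => _ [V [tV EV] <-].
apply: (@le_trans _ _ (inner_content (V `&` U) + outer_content (V `\` U))).
  rewrite leeD//; last by apply: le_outer_content; exact: setSI.
  apply: outer_content_le_inner; last exact: setSI.
  by case: tauT => _ _ tauI _; exact: tauI.
rewrite -leeBrDr ?outer_content_fin_num//.
apply: ge_ereal_sup => _ [K [cK KVU] <-].
have KV : K `<=` V by move=> x /KVU[].
rewrite leeBrDr ?outer_content_fin_num//.
apply: le_trans (inner_content_setD tV cK KV); rewrite leeD2l//.
apply: outer_content_le_inner.
  case: tauT => _ _ tauI _; rewrite setDE; apply: tauI => //.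
  exact: tau_compact_closed.
by apply: setDS => x /KVU[].
Qed.

End compact_regularization.

(** * Visit frequencies along a free ultrafilter *)

(** Compactness of the segment gives a cluster point, and a cluster point of an ultrafilter is a
    limit: otherwise the complement of a neighbourhood would belong to it. *)
Lemma ultrafilter_bounded_cvg (R : realType) (I : Type) (G : set_system I)
    (u : I -> R) (a b : R) : UltraFilter G -> (forall n, a <= u n <= b) ->
  cvg (u n @[n --> G]).
Proof.
move=> GU ab; have GP := @ultra_proper _ _ GU.
have [|p [_ clp]] := @segment_compact R a b (u n @[n --> G]) _.
  by apply: (@filterE _ G) => n; rewrite /= in_itv/=; exact: ab.
apply: (@cvgP _ _ p) => B pB.
have [//|nGB] := @in_ultra_setVsetC _ G (u @^-1` B) GU.
have [y [nBy By]] : ~` B `&` B !=set0 by apply: clp => //; exact: nGB.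
by exfalso.
Qed.

Section orbit_mean.
Context {R : realType} {X : Type} (T : X -> X) (x : X).
Context (G : set_system nat) {GU : UltraFilter G}.
Hypothesis Goo : \oo `<=` G.
Implicit Types (A B : set X).

Definition orbit_average A (N : nat) : R :=
  (\sum_(1 <= n < N.+1) \1_A (iter n T x)) / N%:R.

Definition orbit_mean A : R := lim (orbit_average A N @[N --> G]).

Let GP : ProperFilter G. Proof. exact: ultra_proper. Qed.

Lemma orbit_average_ge0 A N : 0 <= orbit_average A N.
Proof. by rewrite divr_ge0// sumr_ge0. Qed.

Lemma orbit_average_le1 A N : orbit_average A N <= 1.
Proof.
rewrite /orbit_average; case: N => [|N].
  (* At [N = 0] the average is [0], by the convention on the inverse of zero. *)
  by rewrite invr0 mulr0.
rewrite ler_pdivrMr ?ltr0n// mul1r.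
apply: (@le_trans _ _ (\sum_(1 <= n < N.+2) 1)).
  by apply: ler_sum => n _; rewrite indicE lern1 leq_b1.
by rewrite big_const_nat iter_addr_0 subSS subn0.
Qed.

Lemma is_cvg_orbit_average A : cvg (orbit_average A N @[N --> G]).
Proof.
apply: (@ultrafilter_bounded_cvg _ _ _ _ 0 1) => N.
by rewrite orbit_average_ge0 orbit_average_le1.
Qed.

Lemma orbit_mean_ge0 A : 0 <= orbit_mean A.
Proof.
apply: limr_ge; first exact: is_cvg_orbit_average.
by apply: nearW => N; exact: orbit_average_ge0.
Qed.

Lemma orbit_averageU A B : A `&` B = set0 ->
  orbit_average (A `|` B) = orbit_average A + orbit_average B.
Proof.
move=> AB; apply/funext => N; rewrite [RHS]/= /orbit_average.
rewrite -[RHS]mulrDl -big_split/=; congr (_ / _); apply: eq_bigr => n _.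
rewrite !indicE in_setU -natrD; congr (_%:R).
case: (boolP (_ \in A)) => [Ax|_]; last by rewrite add0n.
case: (boolP (_ \in B)) => [Bx|//]; exfalso.
by rewrite -[False]/(set0 (iter n T x)) -AB; split; apply/set_mem.
Qed.

Lemma orbit_meanU A B : A `&` B = set0 ->
  orbit_mean (A `|` B) = orbit_mean A + orbit_mean B.
Proof.
move=> AB; rewrite /orbit_mean orbit_averageU// limD//;
  exact: is_cvg_orbit_average.
Qed.

(** The two sums differ by a shift of the time by one, so their difference telescopes to a
    difference of two indicator values. *)
Lemma orbit_average_preimage A N :
  `|orbit_average (T @^-1` A) N - orbit_average A N| <= N%:R^-1.
Proof.
rewrite -mulrBl normrM [X in _ * X]ger0_norm ?invr_ge0//.
rewrite ler_piMl ?invr_ge0//.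
rewrite (eq_bigr (fun n => \1_A (iter n.+1 T x))); last first.
  by move=> n _; rewrite !indicE.
rewrite -sumrB telescope_sumr//.
rewrite ler_norml !indicE; do 2 case: (_ \in _) => /=; lra.
Qed.

Lemma orbit_mean_preimage A : orbit_mean (T @^-1` A) = orbit_mean A.
Proof.
apply/eqP; rewrite -subr_eq0; apply/eqP.
rewrite /orbit_mean -limB; [|exact: is_cvg_orbit_average..].
(* The difference of the averages tends to [0] in the ordinary sense, hence also along the finer
   filter [G]. *)
apply: cvg_lim => //; apply: cvg_trans (_ : _ @ \oo --> _).
  by apply: cvg_app.
apply/cvgr0Pnorm_lt => e e0; near=> N.
apply: le_lt_trans (orbit_average_preimage A N) _.
have N0 : (0 < N)%N by near: N; exact: nbhs_infty_gt.
rewrite invf_plt ?posrE// ?ltr0n//; near: N.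
exact: nbhs_infty_gtr.
Unshelve. all: by end_near. Qed.

Lemma orbit_mean_gt0 A : (0 < lower_density R T x A)%E -> 0 < orbit_mean A.
Proof.
rewrite /lower_density limn_einf_lim.
(* The lower limit is the supremum of the infima over tails, so some tail has a positive infimum.
   This bounds the averages below on a set that belongs to [G]. *)
rewrite (cvg_lim _ (@cvg_einfs_sup R _))// => /ereal_sup_gt[_ [N _ <-] N0].
have [e e0 eN] : exists2 e : R, 0 < e &
    forall n, (N <= n)%N -> e <= orbit_average A n.
  move: N0; rewrite /einfs/=; set S := (sdrop _ _).
  have SN n : (N <= n)%N -> (ereal_inf S <= (orbit_average A n)%:E)%E.
    by move=> Nn; apply: ereal_inf_lbound; exists n.
  case: (ereal_inf S) SN => [e| |] SN.
  - by rewrite lte_fin => e0; exists e => // n /SN; rewrite lee_fin.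
  - by have := SN N (leqnn N); rewrite leye_eq.
  - by [].
apply: lt_le_trans e0 _; apply: limr_ge; first exact: is_cvg_orbit_average.
by apply: Goo; exists N => // n /=; exact: eN.
Qed.

End orbit_mean.

(** * Borel sets and compact sets of the coarser topology *)

Lemma open_bigcup_tau_compact (R : realType) (X : ptopologicalType)
    (tau : set (set X)) (U : set X) : polish R X ->
  (forall (x : X) (V : set X), nbhs x V ->
     exists K : set X, [/\ nbhs x K, tau_compact tau K & K `<=` V]) ->
  open U -> exists K : nat -> nat -> set X,
    (forall i j, tau_compact tau (K i j)) /\ U = \bigcup_i \bigcup_j K i j.
Proof.
move=> [[D [/pcard_surjP[g gD] dD]] [d [_ d0 dC dT [dopen _]]]] basis oU.
pose dball y (k : nat) := [set z | d y z < k.+1%:R^-1].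
(* To each ball of radius [1 / (j + 1)] about a dense point is attached a compact subset of [U]
   containing it when there is one, and the empty set otherwise. *)
have /choice[F PF] : forall ij : nat * nat, exists K : set X,
    [/\ tau_compact tau K, K `<=` U &
        (exists L,
          [/\ tau_compact tau L, L `<=` U & dball (g ij.1) ij.2 `<=` L]) ->
        dball (g ij.1) ij.2 `<=` K].
  move=> [i j]; have [[L [cL LU bL]]|nL] := pselect (exists L,
    [/\ tau_compact tau L, L `<=` U & dball (g i) j `<=` L]).
    by exists L.
  by exists set0; split => //; exact: tau_compact0.
pose K i j := F (i, j); have PK i j := PF (i, j).
exists K; split=> [i j|]; first by have [] := PK i j.
apply/seteqP; split => [x Ux|x [i _ [j _]]]; last first.
  by have [_ + _] := PK i j; apply.
have [L [nL cL LU]] := basis x U (open_nbhs_nbhs (conj oU Ux)).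
move: nL; rewrite nbhsE => -[W [oW Wx] WL].
have [e e0 eW] := (dopen W).1 oW x Wx.
(* With this radius, a ball about a dense point that is itself within the same radius of [x]
   contains [x] and stays inside the [e]-ball of [x], hence inside [L]. *)
have [k /= ke] : exists k : nat, k.+1%:R^-1 < e / 2.
  have [k _ /(_ k (leqnn k))] :=
    @near_infty_natSinv_lt R (PosNum (divr_gt0 e0 (ltr0Sn _ 1))).
  by exists k.
have dxx y : d y y = 0 by apply/d0.
have odball y j : open (dball y j).
  apply/dopen => z; rewrite /dball/= => yz.
  exists (j.+1%:R^-1 - d y z); first by rewrite subr_gt0.
  by move=> w /=; rewrite ltrBrDl; exact: le_lt_trans.
have [q [xq /gD[i _ giq]]] : dball x k `&` D !=set0.
  by apply: dD => //; exists x; rewrite /dball/= dxx.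
exists i => //; exists k => //; have [_ _] := PK i k; apply; last first.
  by rewrite /dball/= giq dC.
exists L; split => //; apply: subset_trans WL; apply: subset_trans eW.
move=> z; rewrite /dball/= giq => qz; apply: le_lt_trans (dT x q z) _.
by rewrite (splitr e) ltrD//; [exact: lt_trans xq ke|exact: lt_trans qz ke].
Qed.

Section borel_regularization.
Context {R : realType} {X : ptopologicalType} (tau : set (set X)).
Context (nu : set X -> R).
Hypotheses (polishX : polish R X) (tauT : is_topology tau)
  (tauH : tau_hausdorff tau)
  (basis : forall (x : X) (V : set X), nbhs x V ->
     exists K : set X, [/\ nbhs x K, tau_compact tau K & K `<=` V]).
Hypotheses (nu_ge0 : forall A, 0 <= nu A)
  (nuU : forall A B, A `&` B = set0 -> nu (A `|` B) = nu A + nu B).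

Let mu := outer_content_measure tauT tauH nu_ge0 nuU.

(** The Caratheodory measurable sets form a sigma-algebra. It contains the compact sets, whose
    complements are [tau]-open, and therefore their countable unions, among which are all open
    sets. *)
Lemma borel_caratheodory (A : set (borel X)) :
  measurable A -> mu.-caratheodory A.
Proof.
move: A; apply: smallest_sub; first split.
- exact: caratheodory_measurable_set0.
- by move=> A mA; rewrite setTD; exact: caratheodory_measurable_setC.
- by move=> F mF; exact: caratheodory_measurable_bigcup.
move=> U oU; have [K [cK ->]] := open_bigcup_tau_compact polishX basis oU.
apply: caratheodory_measurable_bigcup => i.
apply: caratheodory_measurable_bigcup => j.
rewrite -[K i j]setCK; apply/caratheodory_measurable_setC.
exact/tau_open_caratheodory/tau_compact_closed.
Qed.

Let outer_content_semi_sigma_additive :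
  semi_sigma_additive (outer_content tau nu : set (borel X) -> \bar R).
Proof.
move=> F mF tF mUF; apply: (@caratheodory_measure_sigma_additive _ _ mu) => //.
- by move=> i; exact: borel_caratheodory.
- exact: borel_caratheodory.
Qed.

Definition borel_regularization : {measure set (borel X) -> \bar R} :=
  HB.pack (outer_content tau nu : set (borel X) -> \bar R)
    (isMeasure.Build _ (borel X) R _
      (outer_content0 tauT nuU)
      (outer_content_ge0 tau nuU)
      outer_content_semi_sigma_additive).

End borel_regularization.

(** * Invariance *)

(** For a compact [K] inside the preimage of an open [U], the image [T @]
    K[is compact inside]U[, and]K[lies in the preimage of its image, so]nu K <= nu (T @[K)] by
    invariance of [nu]. *)
Lemma outer_content_preimage_le (R : realType) (X : Type) (tau : set (set X))
    (nu : set X -> R) (T : X -> X) (E : set X) :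
  (forall A, 0 <= nu A) ->
  (forall A B, A `&` B = set0 -> nu (A `|` B) = nu A + nu B) ->
  (forall A, nu (T @^-1` A) = nu A) -> tau_continuous tau T ->
  (outer_content tau nu (T @^-1` E) <= outer_content tau nu E)%E.
Proof.
move=> nu_ge0 nuU nuT cT; apply: le_ereal_inf_tmp => _ [U [tU EU] <-].
apply: (@le_trans _ _ (inner_content tau nu (T @^-1` U))).
  by apply: outer_content_le_inner; [exact: cT|exact: preimage_subset].
apply: ge_ereal_sup => _ [K [cK KU] <-].
apply: (@le_trans _ _ (nu (T @` K))%:E).
  rewrite lee_fin -(nuT (T @` K)); apply: additive_le => //.
  by move=> y Ky; exists y.
apply: inner_content_ub; first exact: tau_compact_image.
by move=> _ [y /KU ? <-].
Qed.

Lemma continuous_borel_preimage (X : ptopologicalType) (T : X -> X)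
    (A : set (borel X)) :
  continuous T -> measurable A -> measurable (T @^-1` A : set (borel X)).
Proof.
move=> /continuousP cT; move: A.
apply: (@smallest_sub _ _ _ [set A | measurable (T @^-1` A : set (borel X))]).
  split => /= [|A mA|F mF]; first by rewrite preimage_set0.
  - by rewrite setTD -preimage_setC; exact: measurableC.
  - by rewrite preimage_bigcup; exact: bigcupT_measurable.
by move=> U oU; apply: sub_sigma_algebra; exact: cT.
Qed.

(** * The invariant probability measure of full support *)

Theorem theorem1p2 (R : realType) (X : ptopologicalType) (T : X -> X)
  (tau : set (set X)) :
  polish R X ->
  continuous T ->
  is_topology tau ->
  tau_hausdorff tau ->
  tau `<=` @open X ->
  (forall (x : X) (U : set X), nbhs x U ->
     exists K : set X, [/\ nbhs x K, tau_compact tau K & K `<=` U]) ->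
  freq_hypercyclic R T ->
  tau_continuous tau T ->
  exists P : probability (borel X) R,
    (forall A : set (borel X), measurable A -> P (T @^-1` A) = P A) /\
    (forall U : set X, open U -> U !=set0 -> (0 < P U)%E).
Proof.
move=> polishX cT tauT tauH _ basis [x0 hx0] ctT.
have [G [GU Goo]] := ultraFilterLemma (@eventually_filter).
pose nu := @orbit_mean R X T x0 G.
have nu_ge0 A : 0 <= nu A by exact: orbit_mean_ge0.
have nuU A B : A `&` B = set0 -> nu (A `|` B) = nu A + nu B.
  exact: orbit_meanU.
have nuT A : nu (T @^-1` A) = nu A by exact: orbit_mean_preimage.
pose m := borel_regularization polishX tauT tauH basis nu_ge0 nuU.
have mE A : m A = outer_content tau nu A by [].
have m_fin A : m A \is a fin_num by exact: outer_content_fin_num.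
have m_open_gt0 (U : set X) : open U -> U !=set0 -> (0 < m U)%E.
  move=> oU [x Ux].
  (* A compact neighbourhood [K] inside [U] contains a nonempty open [V], whence
     [0 < nu V <= nu K <= m U]. *)
  have [K [nK cK KU]] := basis x U (open_nbhs_nbhs (conj oU Ux)).
  move: nK; rewrite nbhsE => -[V [oV Vx] VK].
  have nuV : 0 < nu V.
    by apply: (orbit_mean_gt0 Goo); apply: hx0 => //; exists x.
  apply: (@lt_le_trans _ _ (nu K)%:E).
    by rewrite lte_fin (lt_le_trans nuV)//; exact: additive_le.
  exact: compact_le_outer_content.
have m_preim_le A : (m (T @^-1` A) <= m A)%E.
  exact: outer_content_preimage_le.
have m_preim (A : set (borel X)) : measurable A -> m (T @^-1` A) = m A.
  move=> mA; apply/eqP; rewrite eq_le m_preim_le/=.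
  have mTA := continuous_borel_preimage cT mA.
  have addC (B : set (borel X)) : measurable B -> m setT = (m B + m (~` B))%E.
    by move=> mB; rewrite -measureU ?setUCr ?setICr//; exact: measurableC.
  (* Both decompositions have the same finite total mass, so the inequality for the complement of
     [A] yields the reverse inequality for [A]. *)
  have := addC _ mA; rewrite (addC _ mTA) preimage_setC => mT.
  by rewrite -(@leeD2rE _ (m (~` A)))// -mT leeD2l.
have mT_gt0 : (0 < m setT)%E.
  by apply: m_open_gt0; [exact: openT|exists point].
(* The Dirac mass is only the default value of [mnormalize] for a total mass that is zero or
   infinite; both cases are excluded in [PE]. *)
pose P : probability (borel X) R := mnormalize m (dirac (point : borel X)).
have PE (A : set (borel X)) : P A = (m A * (fine (m setT))^-1%:E)%E.
  rewrite /P/= /mnormalize ifF//; apply/negbTE; rewrite negb_or gt_eqF//=.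
  by have := m_fin setT; rewrite fin_numE => /andP[].
exists P; split=> [A mA|U oU U0]; first by rewrite !PE m_preim.
rewrite PE mule_gt0 ?m_open_gt0// lte_fin invr_gt0 fine_gt0// mT_gt0/=.
by rewrite -ge0_fin_numE ?m_fin// ltW.
Qed.
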